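(* For $p=2$, $R^{\mathrm{pub}}_{1/20}(\textsc{Inverse}_n)=\Omega(n^2)$.
   Context: $\textsc{Inverse}_n$: Alice holds $x\in M_n(\mathbb{F}_2)$, Bob holds $y\in M_n(\mathbb{F}_2)$, with the promise that $x+y$ is invertible over $\mathbb{F}_2$; they must determine whether the top-left entry of $(x+y)^{-1}$ is zero. $R^{\mathrm{pub}}_\delta$ is the $\delta$-error public-coin randomized two-player communication complexity (correct with probability $\ge1-\delta$ on every promise input; cost = worst-case bits communicated). *)

(* Defs.v *)
From mathcomp Require Import all_boot all_order all_algebra.
From mathcomp Require Import boolp classical_sets reals.

Set Implicit Arguments.
Unset Strict Implicit.
Unset Printing Implicit Defensive.

Import Order.TTheory GRing.Theory Num.Theory.

Local Open Scope ring_scope.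
Local Open Scope classical_set_scope.

(* The label of a leaf is the common output of the two players, so the output
   is a function of the transcript. *)
Inductive protocol (X Y : Type) : Type :=
| Output of bool
| Alice of (X -> bool) & protocol X Y & protocol X Y
| Bob of (Y -> bool) & protocol X Y & protocol X Y.

Arguments Output {X Y}.

Fixpoint run (X Y : Type) (t : protocol X Y) (x : X) (y : Y) : bool :=
  match t with
  | Output b => b
  | Alice a t0 t1 => if a x then run t1 x y else run t0 x y
  | Bob b t0 t1 => if b y then run t1 x y else run t0 x y
  end.

Fixpoint depth (X Y : Type) (t : protocol X Y) : nat :=
  match t with
  | Output _ => 0%N
  | Alice _ t0 t1 | Bob _ t0 t1 => (maxn (depth t0) (depth t1)).+1
  end.

Record promise_problem (X Y : Type) := PromiseProblem {
  promise : X -> Y -> bool;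
  answer : X -> Y -> bool
}.

(* A finite coin space loses no generality for finite X and Y: then, up to
   extensional equality, there are only finitely many deterministic protocols
   of a given depth. *)
Record public_protocol (R : realType) (X Y : Type) := PublicProtocol {
  coins : finType;
  coin_prob : coins -> R;
  coin_prob_ge0 : forall w, 0 <= coin_prob w;
  coin_prob_sum1 : \sum_(w : coins) coin_prob w = 1;
  protocol_of : coins -> protocol X Y
}.

Definition cost (R : realType) (X Y : Type) (P : public_protocol R X Y) : nat :=
  (\max_(w : coins P) depth (protocol_of w))%N.

Definition solves (R : realType) (X Y : Type) (delta : R)
    (f : promise_problem X Y) (P : public_protocol R X Y) : Prop :=
  forall x y, promise f x y ->
    1 - delta <=
      \sum_(w : coins P | run (protocol_of w) x y == answer f x y) coin_prob w.

(* The infimum is a minimum when 0 <= delta: see Rpub_attained. *)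
Definition Rpub (R : realType) (X Y : finType) (delta : R)
    (f : promise_problem X Y) : R :=
  inf [set c : R | exists2 P : public_protocol R X Y,
                     solves delta f P & c = (cost P)%:R].

(* Dimension m.+1, so that the top-left entry exists. *)
Definition inverse_problem (m : nat) :
    promise_problem 'M['F_2]_m.+1 'M['F_2]_m.+1 :=
  {| promise := fun x y => x + y \in unitmx;
     answer := fun x y => invmx (x + y) ord0 ord0 == 0 |}.

Fixpoint ask_bob (X Y : eqType) (g : Y -> bool) (s : seq Y) : protocol X Y :=
  if s is y :: s' then
    Bob (fun y' => y' == y) (ask_bob X g s') (Output (g y))
  else Output false.

Fixpoint ask_alice (X Y : eqType) (g : X -> Y -> bool) (s : seq X) (s' : seq Y) :
    protocol X Y :=
  if s is x :: s1 then
    Alice (fun x' => x' == x) (ask_alice g s1 s') (ask_bob X (g x) s')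
  else Output false.

Lemma run_ask_bob (X Y : eqType) (g : Y -> bool) s x y :
  y \in s -> run (ask_bob X g s) x y = g y.
Proof.
elim: s => //= z s IHs; rewrite inE.
by case: eqP => [-> //|_] /=; exact: IHs.
Qed.

Lemma run_ask_alice (X Y : eqType) (g : X -> Y -> bool) s s' x y :
  x \in s -> y \in s' -> run (ask_alice g s s') x y = g x y.
Proof.
move=> xs ys'; elim: s xs => //= z s IHs; rewrite inE.
by case: eqP => [-> _|_] /=; [exact: run_ask_bob|exact: IHs].
Qed.

Lemma solves_exists (R : realType) (X Y : finType) (delta : R)
    (f : promise_problem X Y) :
  0 <= delta -> exists P : public_protocol R X Y, solves delta f P.
Proof.
move=> delta0.
have p0 (w : unit) : 0 <= (fun=> 1 : R) w by exact: ler01.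
have p1 : \sum_(w : unit) (fun=> 1 : R) w = 1.
  by rewrite (bigD1 tt) //= big1 ?addr0 // => -[].
exists (PublicProtocol p0 p1 (fun=> ask_alice (answer f) (enum X) (enum Y))).
move=> x y _ /=; rewrite (eq_bigl xpredT) ?p1 ?gerBl // => w.
by rewrite run_ask_alice ?mem_enum ?eqxx.
Qed.

Lemma Rpub_attained (R : realType) (X Y : finType) (delta : R)
    (f : promise_problem X Y) :
  0 <= delta ->
  exists P : public_protocol R X Y,
    [/\ solves delta f P, Rpub delta f = (cost P)%:R &
        forall Q : public_protocol R X Y,
          solves delta f Q -> (cost P <= cost Q)%N].
Proof.
move=> delta0.
pose A (c : nat) :=
  `[< exists2 P : public_protocol R X Y, solves delta f P & c = cost P >].
have exA : exists c, A c.
  have [P sP] := solves_exists f delta0.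
  by exists (cost P); apply/asboolP; exists P.
case: (ex_minnP exA) => c /asboolP[P sP ->] cmin.
have minP (Q : public_protocol R X Y) :
    solves delta f Q -> (cost P <= cost Q)%N.
  by move=> sQ; apply: cmin; apply/asboolP; exists Q.
exists P; split => //; apply/eqP; rewrite eq_le; apply/andP; split.
  apply: ge_inf; last by exists P.
  by exists 0 => _ [Q _ ->]; rewrite ler0n.
apply: lb_le_inf; first by exists (cost P)%:R; exists P.
by move=> _ [Q sQ ->]; rewrite ler_nat minP.
Qed.

(* Main.v *)
(** A small-cost protocol cannot correlate with Q(z) = sum of (-1)^tr(wz) over
    w in GL_n(F_2): by Parseval, Q(x + y) sums to at most 4^(n^2) in absolute
    value over any rectangle. Revealing the corner of w shows that Q(z) depends
    only on the corank s of z, with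
    2^C(s,2) Q(z) = (-1)^(n-s) 2^C(n,2) |GL_s|,
    so up to sign Q equals 2^C(n,2) on GL_n. Counting left kernels, there are at
    most 2^(n^2) / |GL_s| matrices of corank s, so the l1-norm of Q is at most 12
    times its mass on GL_n. Hence any function of (x, y) which is noticeably
    larger for x + y invertible than for x + y singular needs n^2/2 - O(n) bits.

    A protocol for Inverse gives such a function with O(n) extra bits: for random
    p and r, with z = x + y, the players reveal q = z r and ask for p z^-1 q. If z
    is invertible, this should be p r. If z k = 0 with k <> 0, then q does not
    distinguish r from r + k, so the reply is wrong for half of the r whenever
    p k = 1, hence with probability at least 1/4 overall. The 12th power of the
    acceptance probability separates the two cases enough to beat the l1-norm. *)
Require Import Defs.
From mathcomp Require Import all_boot all_order all_algebra.
From mathcomp Require Import reals.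
From mathcomp Require Import fingroup ring lra zify.
Import Order.TTheory GRing.Theory Num.Theory.
Local Open Scope ring_scope.

Set Implicit Arguments.
Unset Strict Implicit.
Unset Printing Implicit Defensive.

(** * Characters of matrix spaces over F_2 *)

Definition sgn (R : realFieldType) (v : 'F_2) : R := (-1) ^+ (v != 0).

Lemma F2_cases (v : 'F_2) : v = 0 \/ v = 1.
Proof.
by case: v => [[|[|k]] Hk] //; [left|right]; apply/val_inj.
Qed.

Lemma sgn0 (R : realFieldType) : sgn R 0 = 1.
Proof. by rewrite /sgn eqxx. Qed.

Lemma sgn1 (R : realFieldType) : sgn R 1 = -1.
Proof. by rewrite /sgn oner_eq0. Qed.

Lemma sgnD (R : realFieldType) a b : sgn R (a + b) = sgn R a * sgn R b.
Proof.
have F2_11 : 1 + 1 = 0 :> 'F_2 by apply/val_inj.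
by case: (F2_cases a) => ->; case: (F2_cases b) => ->;
  rewrite ?F2_11 ?add0r ?addr0 ?sgn0 ?sgn1 ?mul1r ?mulr1 ?mulrNN ?mulr1.
Qed.

Lemma sgn_sqr (R : realFieldType) a : sgn R a * sgn R a = 1.
Proof.
by case: (F2_cases a) => ->; rewrite ?sgn0 ?sgn1 ?mulrNN mulr1.
Qed.

Lemma sum_sgn_shift (R : realFieldType) (V : finZmodType) (f : V -> 'F_2) (d : V) :
  (forall w, f (w + d) = f w + 1) -> \sum_w sgn R (f w) = 0.
Proof.
move=> fd; have : \sum_w sgn R (f w) = - \sum_w sgn R (f w).
  rewrite [LHS](reindex_inj (addIr d)) /= -sumrN.
  by apply: eq_bigr => w _; rewrite fd sgnD sgn1 mulrN1.
by move/eqP; rewrite -subr_eq0 opprK -mulr2n mulrn_eq0 /= => /eqP.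
Qed.

(** Orthogonality of characters: if [z i j] is nonzero, adding [delta_mx j i] to [w] flips the sign,
    so the terms cancel in pairs. *)
Lemma sum_sgn_tr (R : realFieldType) m n (z : 'M['F_2]_(n, m)) :
  \sum_(w : 'M['F_2]_(m, n)) sgn R (\tr (w *m z)) =
    (z == 0)%:R * 2 ^+ (m * n).
Proof.
have [->|nz] := eqVneq z 0.
  rewrite mul1r (eq_bigr (fun=> 1)) => [|w _].
    by rewrite sumr_const card_mx card_Fp // -natrX.
  by rewrite mulmx0 mxtrace0 sgn0.
rewrite mul0r; have /existsP[i /existsP[j zij]] : [exists i, exists j, z i j != 0].
  apply: contra_neqT nz => /existsPn z0; apply/matrixP => i j; rewrite mxE.
  by move/existsPn/(_ j): (z0 i); rewrite negbK => /eqP.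
apply: (@sum_sgn_shift _ _ _ (delta_mx j i)) => w.
rewrite mulmxDl mxtraceD; congr (_ + _).
have -> : \tr (delta_mx j i *m z) = z i j.
  rewrite mxtrace_mulC /mxtrace (bigD1 i) //= big1 ?addr0 => [|k ki].
    rewrite mxE (bigD1 j) //= big1 ?addr0 ?mxE ?eqxx ?mulr1 // => l lj.
    by rewrite mxE (negPf lj) mulr0.
  by rewrite mxE big1 // => l _; rewrite mxE (negPf ki) andbF mulr0.
by case: (F2_cases (z i j)) zij => ->; rewrite ?eqxx.
Qed.

(** * The Fourier transform of GL_n on rectangles *)

Definition rect_bound (R : realFieldType) (X Y : finType) (g : X -> Y -> R) (c : R) :=
  forall (A : pred X) (B : pred Y),
    `|\sum_(x | A x) \sum_(y | B y) g x y| <= c.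

Definition GL_fourier (R : realFieldType) n (z : 'M['F_2]_n) : R :=
  \sum_(w : 'M['F_2]_n | w \in unitmx) sgn R (\tr (w *m z)).

(** Once the square is expanded, orthogonality leaves only the diagonal pairs, at most 2^(n^2) of
    them, each worth 2^(n^2). *)
Lemma parseval_indicator (R : realFieldType) n (A : pred 'M['F_2]_n) :
  \sum_w (\sum_(x | A x) sgn R (\tr (w *m x))) ^+ 2 <= 2 ^+ (n * n) * 2 ^+ (n * n).
Proof.
rewrite (eq_bigr (fun w => \sum_(x | A x) \sum_(y | A y) sgn R (\tr (w *m (x - y))))); last first.
  move=> w _; rewrite expr2 mulr_suml; apply: eq_bigr => x _.
  rewrite mulr_sumr; apply: eq_bigr => y _.
  rewrite -[in sgn R (\tr (w *m x))](subrK y x) mulmxDr mxtraceD sgnD -mulrA.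
  by rewrite sgn_sqr mulr1.
rewrite exchange_big /=; under eq_bigr do rewrite exchange_big /=.
under eq_bigr do under eq_bigr do rewrite sum_sgn_tr.
rewrite (eq_bigr (fun=> 2 ^+ (n * n))) => [|x Ax].
  rewrite sumr_const -[leLHS]mulr_natr; apply: ler_wpM2l; first by rewrite exprn_ge0.
  rewrite -natrX ler_nat (leq_trans (max_card _)) // card_mx card_Fp //.
rewrite (bigD1 x) //= subrr eqxx mul1r big1 ?addr0 // => y /andP[_ yx].
by rewrite subr_eq0 eq_sym (negPf yx) mul0r.
Qed.

(** For each [w] the character is multiplicative in [x + y], so the rectangle sum is a sum of
    products of the transforms of [A] and [B]. The inequality 2ab <= a^2 + b^2 reduces it to
    Parseval. *)
Lemma GL_fourier_rect_bound (R : realFieldType) n :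
  rect_bound (fun x y : 'M['F_2]_n => GL_fourier R (x + y))
    (2 ^+ (n * n) * 2 ^+ (n * n)).
Proof.
move=> A B.
pose ft C w : R := \sum_(x : 'M['F_2]_n | C x) sgn R (\tr (w *m x)).
have -> : \sum_(x | A x) \sum_(y | B y) GL_fourier R (x + y) =
          \sum_(w : 'M['F_2]_n | w \in unitmx) ft A w * ft B w.
  under eq_bigr do rewrite exchange_big /=.
  rewrite exchange_big /=; apply: eq_bigr => w _.
  rewrite mulr_suml; apply: eq_bigr => x _; rewrite mulr_sumr.
  by apply: eq_bigr => y _; rewrite mulmxDr mxtraceD sgnD.
apply: le_trans (ler_norm_sum _ _ _) _.
have -> : 2 ^+ (n * n) * 2 ^+ (n * n) =
  2^-1 * (2 ^+ (n * n) * 2 ^+ (n * n) + 2 ^+ (n * n) * 2 ^+ (n * n)) :> R.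
  by field.
apply: (@le_trans _ _ (2^-1 * \sum_w (ft A w ^+ 2 + ft B w ^+ 2))); last first.
  rewrite big_split /= ler_wpM2l ?invr_ge0 //.
  by apply: lerD; apply: parseval_indicator.
rewrite mulr_sumr [leRHS](bigID (fun w => w \in unitmx)) /= -[leLHS]addr0.
apply: lerD; last by apply: sumr_ge0 => w _; rewrite mulr_ge0 ?invr_ge0 ?addr_ge0 ?sqr_ge0.
apply: ler_sum => w _; rewrite normrM -[ft A w ^+ 2]real_normK ?num_real //.
rewrite -[ft B w ^+ 2]real_normK ?num_real //.
have := sqr_ge0 (`|ft A w| - `|ft B w|); nra.
Qed.

(** * Values of the transform by rank *)

Lemma GL_fourier_equiv (R : realFieldType) n (u v z : 'M['F_2]_n) :
  u \in unitmx -> v \in unitmx ->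
  GL_fourier R (u *m z *m v) = GL_fourier R z.
Proof.
move=> uu uv; rewrite /GL_fourier.
rewrite [RHS](reindex (fun w => v *m w *m u)) /=; last first.
  exists (fun w => invmx v *m w *m invmx u) => w _.
    by rewrite !mulmxA mulVmx // mul1mx -mulmxA mulmxV // mulmx1.
  by rewrite !mulmxA mulmxV // mul1mx -mulmxA mulVmx // mulmx1.
apply: eq_big => [w|w _]; first by rewrite !unitmx_mul uu uv andbT.
by rewrite !mulmxA mxtrace_mulC !mulmxA.
Qed.

Lemma F2_opp (v : 'F_2) : - v = v.
Proof. by case: (F2_cases v) => ->; apply/val_inj. Qed.

Lemma F2_big (R : realFieldType) (f : 'F_2 -> R) : \sum_a f a = f 0 + f 1.
Proof.
rewrite (bigD1 0) //= (bigD1 1) //= big1 ?addr0 // => a.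
by case: (F2_cases a) => ->; rewrite eqxx // andbF.
Qed.

Lemma sum_block_mx (R : realFieldType) n (f : 'M['F_2]_(1 + n) -> R) :
  \sum_w f w =
  \sum_(d : 'M_n) \sum_(c : 'cV_n) \sum_(b : 'rV_n) \sum_(a : 'F_2)
    f (block_mx a%:M b c d).
Proof.
rewrite pair_big /= pair_big /= pair_big /=.
rewrite (reindex (fun p : 'M['F_2]_n * 'cV['F_2]_n * 'rV['F_2]_n * 'F_2 =>
  block_mx p.2%:M p.1.2 p.1.1.2 p.1.1.1)) //=.
exists (fun w : 'M_(1 + n) => (drsubmx w, dlsubmx w, ursubmx w, ulsubmx w 0 0))
  => [[[[d c] b] a]|w] _ /=.
  by rewrite block_mxKdr block_mxKdl block_mxKur block_mxKul mxE eqxx.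
by rewrite -[RHS]submxK; congr block_mx; rewrite -mx11_scalar.
Qed.

Lemma det_block_corner (F : comNzRingType) n (a : F) (b : 'rV_n) (c : 'cV_n) (d : 'M_n) :
  \det (block_mx a%:M b c d) = a * \det d + \det (block_mx 0 b c d).
Proof.
have rE (z : 'M_1) (b' : 'rV_n) : row' (0 : 'I_(1 + n)) (block_mx z b' c d) = row_mx c d.
  by apply/matrixP => i j; rewrite mxE [lift _ _](_ : _ = rshift 1 i) ?col_mxEd //; apply/val_inj.
have r0E (z : 'M_1) (b' : 'rV_n) : row (0 : 'I_(1 + n)) (block_mx z b' c d) = row_mx z b'.
  have -> : 0 = lshift n 0 :> 'I_(1 + n) by apply/val_inj.
  by apply/rowP => j; rewrite mxE col_mxEu.
rewrite -(raddf0 (@scalar_mx F 1)) -(mul1r (\det (block_mx 0%:M _ _ _))).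
have -> : \det d = \det (block_mx (1%:M : 'M_1) 0 c d) by rewrite det_lblock det1 mul1r.
apply: (determinant_multilinear (i0 := 0)); rewrite ?rE //.
apply/rowP => j; rewrite !r0E !mxE.
by case: (split (j : 'I_(1 + n))) => k;
  rewrite !mxE ?ord1 ?mulr1n ?mulr1 ?mulr0 ?addr0 ?mul1r ?add0r.
Qed.

Lemma det_block_corner0 (F : fieldType) n (b : 'rV[F]_n) (c : 'cV_n) (d : 'M_n) :
  d \in unitmx ->
  \det (block_mx 0 b c d) = - (b *m invmx d *m c) 0 0 * \det d.
Proof.
move=> ud.
have -> : block_mx 0 b c d = block_mx 1%:M (b *m invmx d) 0 1%:M *m
                            block_mx (- (b *m invmx d *m c)) 0 c d.
  rewrite mulmx_block !mul1mx !mul0mx !add0r mulmxKV //.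
  by rewrite addNr.
by rewrite det_mulmx det_ublock det_lblock !det1 !mul1r det_mx11 mxE.
Qed.

(** By the Schur complement the determinant is the bilinear form b d^-1 c, and summing over [b]
    kills every nonzero [c]. *)
Lemma sum_sgn_corner (R : realFieldType) n (d : 'M['F_2]_n) :
  d \in unitmx ->
  \sum_(c : 'cV_n) \sum_(b : 'rV_n) sgn R (\det (block_mx 0 b c d)) = 2 ^+ n.
Proof.
move=> ud; have detd : \det d = 1.
  by move: ud; rewrite unitmxE; case: (F2_cases (\det d)) => ->; rewrite ?unitr0.
under eq_bigr => c _ do under eq_bigr => b _ do
  rewrite det_block_corner0 // detd mulr1 F2_opp -mulmxA -trace_mx11.
under eq_bigr do rewrite sum_sgn_tr mul1n.
rewrite (bigD1 0) //= mulmx0 eqxx mul1r big1 ?addr0 // => c c0.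
have [dc0|] := eqVneq (invmx d *m c) 0; last by rewrite mul0r.
by case/eqP: c0; rewrite -(mulKVmx ud c) dc0 mulmx0.
Qed.

(** Fix the lower right block [d]. If it is singular, the corner has no influence on invertibility
    and its two values cancel. If it is invertible, the corner must be
    [1 + \det (block_mx 0 b c d)], and this 1 produces the minus sign. *)
Lemma GL_fourier_block (R : realFieldType) n (z : 'M['F_2]_n) :
  GL_fourier R (block_mx 1%:M 0 0 z : 'M_(1 + n)) = - 2 ^+ n * GL_fourier R z.
Proof.
rewrite /GL_fourier big_mkcond /= sum_block_mx.
rewrite [in RHS]big_mkcond mulr_sumr; apply: eq_bigr => d _.
have trE a b c : \tr (block_mx (a%:M : 'M['F_2]_1) b c d *m block_mx 1%:M 0 0 z) = a + \tr (d *m z).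
  by rewrite mulmx_block mxtrace_block !mulmx1 !mulmx0 addr0 add0r mxtrace_scalar.
have [ud|nud] := ifPn.
  have detd : \det d = 1.
    by move: ud; rewrite unitmxE; case: (F2_cases (\det d)) => ->; rewrite ?unitr0.
  rewrite mulNr -mulrN -(sum_sgn_corner R ud) mulr_suml; apply: eq_bigr => c _.
  rewrite mulr_suml; apply: eq_bigr => b _.
  (* Exactly one value of the corner makes the block matrix invertible. *)
  rewrite F2_big !unitmxE !det_block_corner !trE detd mul0r add0r mul1r !sgnD.
  rewrite sgn0 sgn1.
  have F2_11 : 1 + 1 = 0 :> 'F_2 by apply/val_inj.
  by case: (F2_cases (\det (block_mx 0 b c d))) => ->;
    rewrite ?sgn0 ?sgn1 ?addr0 ?F2_11 ?unitr0 ?unitr1; ring.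
have detd : \det d = 0.
  by move: nud; rewrite unitmxE; case: (F2_cases (\det d)) => ->; rewrite ?unitr1.
rewrite mulr0 big1 // => c _; rewrite big1 // => b _.
rewrite F2_big !unitmxE !det_block_corner !trE detd !mulr0 add0r.
by case: ifP => _; rewrite ?addr0 // !sgnD sgn0 sgn1; ring.
Qed.

Definition nGL n : nat := #|[pred w : 'M['F_2]_n | w \in unitmx]|.

Lemma GL_fourier0 (R : realFieldType) n : GL_fourier R (0 : 'M_n) = (nGL n)%:R.
Proof.
rewrite /GL_fourier (eq_bigr (fun=> 1)) => [|w _]; first by rewrite sumr_const.
by rewrite mulmx0 mxtrace0 sgn0.
Qed.

(** Each diagonal 1 contributes -2^k, where k is the size of the remaining block; these exponents
    add up to ['C(r + s, 2) - 'C(s, 2)]. The factor on the left avoids the subtraction. *)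
Lemma GL_fourier_pid (R : realFieldType) r s :
  2 ^+ 'C(s, 2) * GL_fourier R (pid_mx r : 'M_(r + s)) =
    (-1) ^+ r * 2 ^+ 'C(r + s, 2) * (nGL s)%:R.
Proof.
elim: r => [|r IHr]; first by rewrite pid_mx_0 GL_fourier0 add0n !mul1r.
have -> : pid_mx r.+1 = block_mx 1%:M 0 0 (pid_mx r) :> 'M['F_2]_(1 + (r + s)).
  apply/matrixP => i j; rewrite [LHS]mxE.
  case: (split_ordP i) => i' ->; case: (split_ordP j) => j' ->;
  by rewrite ?block_mxEul ?block_mxEur ?block_mxEdl ?block_mxEdr !mxE ?ord1 //= ?add1n ?eqSS ?ltnS.
rewrite GL_fourier_block mulrCA IHr addSn binS bin1 exprD exprS; ring.
Qed.

Lemma GL_fourier_rank (R : realFieldType) n r s (z : 'M['F_2]_n) :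
  n = (r + s)%N -> \rank z = r ->
  2 ^+ 'C(s, 2) * GL_fourier R z = (-1) ^+ r * 2 ^+ 'C(n, 2) * (nGL s)%:R.
Proof.
move=> nrs rz; rewrite -[z]mulmx_ebase GL_fourier_equiv ?col_ebase_unit ?row_ebase_unit //.
by rewrite rz; subst n; apply: GL_fourier_pid.
Qed.

(** * Counting matrices of given corank *)

Lemma left_kernel_basis (F : fieldType) n r s (z : 'M[F]_n) :
  n = (r + s)%N -> \rank z = r -> exists2 k : 'M_(s, n), row_free k & k *m z = 0.
Proof.
move=> nrs rz; have : \rank (kermx z) = s by rewrite mxrank_ker rz nrs addKn.
move: (row_base_free (kermx z)) (eq_row_base (kermx z)).
move: (row_base (kermx z)); move: (\rank (kermx z)) => t k fk ek ts; subst t.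
by exists k => //; apply/sub_kermxP; rewrite ek.
Qed.

(** Double counting: a matrix of corank s has |GL_s| ordered bases of its left kernel, while each
    basis annihilates 2^(n^2 - sn) matrices, and there are at most 2^(sn) bases. The extra component
    [t] turns this into an injection. *)
Lemma card_rank_nGL n r s : n = (r + s)%N ->
  (#|[pred z : 'M['F_2]_n | \rank z == r]| * nGL s <= 2 ^ (n * n))%N.
Proof.
move=> nrs.
pose ker (z : 'M['F_2]_n) : 'M_(s, n) :=
  odflt 0 [pick k | row_free k && (k *m z == 0)].
have kerP z : \rank z = r -> row_free (ker z) /\ ker z *m z = 0.
  move=> rz; rewrite /ker; case: pickP => [k /andP[? /eqP]|] //.
  have [k fk kz] := left_kernel_basis nrs rz.
  by move/(_ k); rewrite fk kz eqxx.
pose D := [predX [predX [pred z : 'M['F_2]_n | \rank z == r] &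
  [pred g : 'M['F_2]_s | g \in unitmx]] & xpredT : pred 'M['F_2]_(s, n)].
(* Since k is row free and kills z, t is recovered as k (z + pinvmx k t). *)
pose f (p : 'M['F_2]_n * 'M['F_2]_s * 'M['F_2]_(s, n)) :=
  let k := p.1.2 *m ker p.1.1 in (k, p.1.1 + pinvmx k *m p.2).
have finj : {in D &, injective f}.
  move=> [[z g] t] [[z' g'] t'].
  rewrite !inE /= !andbT => /andP[/eqP rz ug] /andP[/eqP rz' ug'] [kk].
  have [fz kz] := kerP z rz; have [fz' kz'] := kerP z' rz'.
  have fk : row_free (g *m ker z) by rewrite /row_free mxrankMfree // mxrank_unit.
  rewrite -kk => zt; have tt : t = t'.
    have := congr1 (mulmx (g *m ker z)) zt.
    rewrite /= !mulmxDr !(mulmxA (g *m ker z) (pinvmx _)) mulmxVp // !mul1mx.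
    by rewrite -(mulmxA g) kz mulmx0 kk -(mulmxA g') kz' mulmx0 !add0r.
  move: zt kk; rewrite tt => /addIr <- kk; congr (_, _, _).
  exact: (row_free_inj fz).
have cardM p q : #|{: 'M['F_2]_(p, q)}| = (2 ^ (p * q))%N by rewrite card_mx card_Fp.
have cardD : #|D| = (#|[pred z : 'M['F_2]_n | \rank z == r]| * nGL s * 2 ^ (s * n))%N.
  by rewrite !cardX -cardM; congr (_ * _)%N; apply: eq_card.
have : (#|D| <= #|{: 'M['F_2]_(s, n) * 'M['F_2]_n}|)%N.
  by rewrite -(card_in_image finj) max_card.
by rewrite cardD card_prod !cardM [leqRHS]mulnC leq_pmul2r // expn_gt0.
Qed.

Lemma nGL_GL n : (0 < n)%N -> nGL n = #|('GL_n['F_2])%g|.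
Proof. by case: n => // n _; rewrite cardsT card_sub. Qed.

Lemma nGL_ge n : (2 ^ (n * n) <= 4 * nGL n)%N.
Proof.
case: n => [|n].
  rewrite /nGL (eq_card (B := predT)) ?card_mx ?mul0n // => w.
  by rewrite !inE unitmxE det_mx00 unitr1.
rewrite nGL_GL // card_GL // card_Fp //.
(* prod_(1 <= i <= k+1) (1 - 2^-i) >= 1/4 + 2^-(k+2): the last term makes the
   induction go through. *)
have bnd k : (2 ^ 'C(k.+2, 2) * (2 ^ k + 1) <=
    2 ^ k.+2 * \prod_(1 <= i < k.+2) (2 ^ i - 1))%N.
  elim: k => [|k IHk]; first by rewrite big_nat1.
  rewrite big_nat_recr //= [in leqLHS]binS bin1 expnD.
  move: IHk; set P := (\prod_(1 <= i < k.+2) (2 ^ i - 1))%N; set c := (2 ^ 'C(_, _))%N.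
  rewrite !expnS; have : (0 < 2 ^ k)%N by rewrite expn_gt0.
  set x := (2 ^ k)%N => x0 IH.
  have [m mE] : exists m, (2 * (2 * x) = m.+1)%N by exists (4 * x).-1; lia.
  rewrite mE subn1 /=; have : (c * (x + 1) * (2 * m) <= 2 * (2 * x) * P * (2 * m))%N.
    by rewrite leq_mul2r IH orbT.
  rewrite mE => H; have -> : (2 * m.+1 * (P * m) = m.+1 * P * (2 * m))%N by ring.
  by apply: leq_trans H; rewrite -!mulnA leq_mul2l; apply/orP; right; nia.
(* This splits the exponent so that the power of 2 in [card_GL] cancels. *)
have sqE : (n.+1 * n.+1 = 'C(n.+1, 2) + 'C(n.+2, 2))%N.
  by have := mul_bin_diag n.+1 1; rewrite (binS n.+1) !bin1 /=; lia.
rewrite sqE expnD mulnCA leq_mul2l; apply/orP; right.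
have := bnd n; rewrite [in 'C(n.+2, 2)]binS bin1.
set P := (\prod_(1 <= i < n.+2) (2 ^ i - 1))%N; set c := (2 ^ (_ + _))%N.
rewrite !expnS; have : (0 < 2 ^ n)%N by rewrite expn_gt0.
set y := (2 ^ n)%N => y0 H; rewrite -(leq_pmul2r y0); nia.
Qed.

(** * The l1-norm of the transform and its correlation with other functions *)

Lemma GL_fourier_unit (R : realFieldType) n (z : 'M['F_2]_n) :
  z \in unitmx -> (-1) ^+ n * GL_fourier R z = 2 ^+ 'C(n, 2).
Proof.
move=> uz; have nGL0 : nGL 0 = 1%N.
  rewrite /nGL (eq_card (B := predT)) ?card_mx // => w.
  by rewrite !inE unitmxE det_mx00 unitr1.
have := GL_fourier_rank R (esym (addn0 n)) (mxrank_unit uz).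
rewrite nGL0 mulr1 bin0n mul1r => ->.
by rewrite mulrA -exprMn mulrNN mulr1 expr1n mul1r.
Qed.

Lemma sum_inv_pow_bin2 (R : realFieldType) n :
  \sum_(s < n.+1) (2 ^+ 'C(s, 2))^-1 <= 3 :> R.
Proof.
(* The strengthened bound carries the tail of the geometric series that dominates the sum, since
   ['C(s.+1, 2)] is at least [s]. *)
suff : \sum_(s < n.+1) (2 ^+ 'C(s, 2))^-1 <= 3 - 2 / 2 ^+ n :> R.
  by move=> /le_trans->//; rewrite gerBl divr_ge0 ?exprn_ge0.
elim: n => [|n IHn]; first by rewrite big_ord1 bin0n; lra.
rewrite big_ord_recr /=.
have : (2 ^+ 'C(n.+1, 2))^-1 <= (2 ^+ n)^-1 :> R.
  rewrite lef_pV2 ?posrE ?exprn_gt0 // ler_weXn2l ?ler1n //.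
  by rewrite binS bin1 leq_addl.
rewrite exprS invfM => H; have := lerD IHn H; lra.
Qed.

(** Grouped by corank s, the factor |GL_s| in the transform cancels against the count in
    [card_rank_nGL], which leaves the series of 2^-C(s,2). *)
Lemma GL_fourier_norm1 (R : realFieldType) n :
  \sum_(z : 'M['F_2]_n) `|GL_fourier R z| <= 3 * (2 ^+ 'C(n, 2) * 2 ^+ (n * n)).
Proof.
rewrite (partition_big (fun z : 'M_n => inord (n - \rank z) : 'I_n.+1) xpredT) //=.
apply: (@le_trans _ _ (\sum_(s < n.+1)
   ((2 ^+ 'C(s, 2))^-1 * (2 ^+ 'C(n, 2) * 2 ^+ (n * n))))); last first.
  by rewrite -mulr_suml ler_wpM2r ?sum_inv_pow_bin2 // mulr_ge0 ?exprn_ge0.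
apply: ler_sum => s _; have nE : n = (n - s + s)%N by rewrite subnK // -ltnS.
rewrite (eq_bigl [pred z : 'M_n | \rank z == n - s]%N) => [|z]; last first.
  rewrite /= -val_eqE /= inordK ?ltnS ?leq_subr //.
  have := rank_leq_row z; have := ltn_ord s; lia.
rewrite (eq_bigr (fun=> (2 ^+ 'C(s, 2))^-1 * (2 ^+ 'C(n, 2) * (nGL s)%:R))) => [|z /= /eqP rz].
  rewrite sumr_const -[leLHS]mulr_natr -!mulrA ler_wpM2l ?invr_ge0 ?exprn_ge0 //.
  rewrite ler_wpM2l ?exprn_ge0 // -natrM -natrX ler_nat mulnC.
  exact: card_rank_nGL nE.
have := GL_fourier_rank R nE rz; set a := 2 ^+ 'C(s, 2).
have a0 : 0 < a by rewrite exprn_gt0.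
move=> H; have -> : GL_fourier R z = a^-1 * ((-1) ^+ (n - s) * 2 ^+ 'C(n, 2) * (nGL s)%:R).
  by rewrite -H mulKf // lt0r_neq0.
rewrite !normrM normrX normrN1 expr1n mul1r !ger0_norm ?invr_ge0 ?exprn_ge0 ?ler0n //.
Qed.

(** On invertible sums the signed transform is constantly 2^C(n,2), and these are at least a quarter
    of all matrices by [nGL_ge]. Elsewhere the loss is at most [beta] times the l1-norm. Each matrix
    is the sum of 2^(n^2) pairs. *)
Lemma GL_fourier_correlation (R : realFieldType) n (alpha beta : R)
    (h : 'M['F_2]_n -> 'M['F_2]_n -> R) :
  0 <= alpha -> 0 <= beta ->
  (forall x y, x + y \in unitmx -> alpha <= h x y) ->
  (forall x y, x + y \notin unitmx -> `|h x y| <= beta) ->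
  (alpha / 4 - 3 * beta) * (2 ^+ 'C(n, 2) * (2 ^+ (n * n) * 2 ^+ (n * n))) <=
  \sum_x \sum_y (-1) ^+ n * GL_fourier R (x + y) * h x y.
Proof.
move=> alpha0 beta0 hu hs.
pose lo (z : 'M['F_2]_n) : R :=
  if z \in unitmx then alpha * 2 ^+ 'C(n, 2) else - (beta * `|GL_fourier R z|).
apply: (@le_trans _ _ (\sum_(x : 'M['F_2]_n) \sum_y lo (x + y))); last first.
  apply: ler_sum => x _; apply: ler_sum => y _; rewrite /lo.
  case: ifPn => uz.
    by rewrite GL_fourier_unit // mulrC ler_wpM2l ?exprn_ge0 ?hu.
  rewrite lerNl; apply: le_trans (ler_norm _) _.
  by rewrite normrN !normrM normrX normrN1 expr1n mul1r mulrC ler_wpM2r ?hs.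
rewrite (eq_bigr (fun=> \sum_z lo z)) => [|x _]; last first.
  by rewrite [RHS](reindex_inj (addrI x)).
rewrite sumr_const card_mx card_Fp // -[leRHS]mulr_natl natrX.
rewrite [leLHS](_ : _ = 2 ^+ (n * n) *
  ((alpha / 4 - 3 * beta) * (2 ^+ 'C(n, 2) * 2 ^+ (n * n)))); last by ring.
rewrite ler_wpM2l ?exprn_ge0 // (bigID (fun z => z \in unitmx)) /=.
rewrite (eq_bigr (fun=> alpha * 2 ^+ 'C(n, 2))) => [|z uz]; last by rewrite /lo uz.
rewrite [X in _ <= _ + X](eq_bigr (fun z => - (beta * `|GL_fourier R z|))) => [|z uz]; last first.
  by rewrite /lo (negPf uz).
rewrite sumr_const -/(nGL n) -(mulr_natr (alpha * _)) sumrN -mulr_sumr mulrBl; apply: lerB.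
  rewrite [leRHS](_ : _ = (alpha / 4 * 2 ^+ 'C(n, 2)) * (4 * (nGL n)%:R)); last by field.
  rewrite [leLHS]mulrA. rewrite ler_wpM2l ?mulr_ge0 ?invr_ge0 ?exprn_ge0 //.
  by rewrite -natrX -natrM ler_nat nGL_ge.
rewrite -mulrA mulrCA ler_wpM2l //; apply: le_trans (GL_fourier_norm1 R n).
rewrite [leRHS](bigID (fun z => z \in unitmx)) /= lerDr.
by apply: sumr_ge0 => z _.
Qed.

(** * The effect of communication on rectangle bounds *)

(* Each bit of communication at most doubles the rectangle bound, so protocols
   are handled through multipliers and need not be composed explicitly. *)
Definition multiplier (R : realFieldType) (X Y : finType) (L : R) (h : X -> Y -> R) :=
  forall g c, rect_bound g c -> rect_bound (fun x y => g x y * h x y) (L * c).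

Lemma rect_bound_ge0 (R : realFieldType) (X Y : finType) (g : X -> Y -> R) c :
  rect_bound g c -> 0 <= c.
Proof. by move=> /(_ pred0 pred0); rewrite big_pred0 // normr0. Qed.

Lemma eq_multiplier (R : realFieldType) (X Y : finType) L (h h' : X -> Y -> R) :
  multiplier L h -> (forall x y, h x y = h' x y) -> multiplier L h'.
Proof.
move=> mh hh' g c gc A B.
under eq_bigr do under eq_bigr do rewrite -hh'.
exact: mh.
Qed.

Lemma multiplier_le (R : realFieldType) (X Y : finType) L L' (h : X -> Y -> R) :
  L <= L' -> multiplier L h -> multiplier L' h.
Proof.
move=> LL' mh g c gc A B; apply: le_trans (mh g c gc A B) _.
by rewrite ler_wpM2r // (rect_bound_ge0 gc).
Qed.

Lemma multiplierM (R : realFieldType) (X Y : finType) L L' (h h' : X -> Y -> R) :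
  multiplier L h -> multiplier L' h' ->
  multiplier (L' * L) (fun x y => h x y * h' x y).
Proof.
move=> mh mh' g c gc A B; rewrite -mulrA.
under eq_bigr do under eq_bigr do rewrite mulrA.
exact: (mh' _ _ (mh _ _ gc)).
Qed.

Lemma multiplierX (R : realFieldType) (X Y : finType) L (h : X -> Y -> R) k :
  multiplier L h -> multiplier (L ^+ k) (fun x y => h x y ^+ k).
Proof.
move=> mh; elim: k => [|k IHk].
  move=> g c gc A B; rewrite mul1r.
  by under eq_bigr do under eq_bigr do rewrite mulr1; exact: gc.
rewrite exprS; refine (eq_multiplier (multiplierM IHk mh) _) => x y.
by rewrite exprSr.
Qed.

Lemma multiplier_sum (R : realFieldType) (X Y I : finType) L (p : I -> R)
    (h : I -> X -> Y -> R) :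
  (forall i, 0 <= p i) -> (forall i, multiplier L (h i)) ->
  multiplier ((\sum_i p i) * L) (fun x y => \sum_i p i * h i x y).
Proof.
move=> p0 mh g c gc A B.
have -> : \sum_(x | A x) \sum_(y | B y) g x y * (\sum_i p i * h i x y) =
          \sum_i p i * \sum_(x | A x) \sum_(y | B y) g x y * h i x y.
  under [RHS]eq_bigr do rewrite mulr_sumr.
  rewrite [RHS]exchange_big; apply: eq_bigr => x _.
  under [RHS]eq_bigr do rewrite mulr_sumr.
  rewrite [RHS]exchange_big; apply: eq_bigr => y _.
  by rewrite mulr_sumr; apply: eq_bigr => i _; rewrite mulrCA.
rewrite -mulrA mulr_suml; apply: le_trans (ler_norm_sum _ _ _) _.
apply: ler_sum => i _; rewrite normrM ger0_norm // ler_wpM2l //.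
exact: mh.
Qed.

Lemma multiplier_rect (R : realFieldType) (X Y : finType) (A : pred X) (B : pred Y) :
  multiplier 1 (fun x y => (A x && B y)%:R : R).
Proof.
move=> g c gc A' B'; rewrite mul1r.
have -> : \sum_(x | A' x) \sum_(y | B' y) g x y * (A x && B y)%:R =
    \sum_(x | A' x && A x) \sum_(y | B' y && B y) g x y.
  rewrite [RHS]big_mkcondr; apply: eq_bigr => x _.
  case: (A x) => /=; last by rewrite big1 // => y _; rewrite mulr0.
  by rewrite [RHS]big_mkcondr; apply: eq_bigr => y _; case: (B y); rewrite ?mulr1 ?mulr0.
exact: (gc [pred x | A' x && A x] [pred y | B' y && B y]).
Qed.

(** At a node the indicator splits into two terms, each the indicator of a rectangle times that of a
    subprotocol, which doubles the bound. The maps [f] and [f'] are local preprocessing, used by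
    [probe] to change bases. *)
Lemma multiplier_run (R : realFieldType) (X Y : finType) (X' Y' : Type)
    (t : protocol X' Y') (f : X -> X') (f' : Y -> Y') (b : bool) :
  multiplier (2 ^+ depth t) (fun x y => (run t (f x) (f' y) == b)%:R : R).
Proof.
pose r s := fun x y => (run s (f x) (f' y) == b)%:R : R.
have node (A : pred X) (B : pred Y) (A' : pred X) (B' : pred Y) t0 t1 (h : X -> Y -> R) :
    multiplier (2 ^+ depth t0) (r t0) -> multiplier (2 ^+ depth t1) (r t1) ->
    (forall x y, (A x && B y)%:R * r t0 x y + (A' x && B' y)%:R * r t1 x y = h x y) ->
    multiplier (2 ^+ (maxn (depth t0) (depth t1)).+1) h.
  move=> m0 m1 E.
  pose hs c := fun x y => if c then (A' x && B' y)%:R * r t1 x y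
                          else (A x && B y)%:R * r t0 x y.
  have mhs c : multiplier (2 ^+ maxn (depth t0) (depth t1)) (hs c).
    case: c; [refine (multiplier_le _ (multiplierM (multiplier_rect _ _) m1))|
              refine (multiplier_le _ (multiplierM (multiplier_rect _ _) m0))];
    by rewrite mulr1 ler_weXn2l ?ler1n // ?leq_maxl ?leq_maxr.
  have := multiplier_sum (fun=> ler01 : 0 <= 1 :> R) mhs.
  rewrite sumr_const card_bool exprS => mh; refine (eq_multiplier mh _) => x y.
  by rewrite big_bool /= !mul1r addrC E.
elim: t => [c|a t0 m0 t1 m1|c t0 m0 t1 m1] /=.
- rewrite expr0; refine (eq_multiplier (multiplier_rect (fun=> c == b) (fun=> true)) _) => x y.
  by rewrite andbT.
- apply: (node (fun x => ~~ a (f x)) (fun=> true) (fun x => a (f x)) (fun=> true)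
    _ _ _ m0 m1) => x y.
  by rewrite !andbT /r; case: (a (f x)); rewrite /= ?mul0r ?mul1r ?add0r ?addr0.
- apply: (node (fun=> true) (fun y => ~~ c (f' y)) (fun=> true) (fun y => c (f' y))
    _ _ _ m0 m1) => x y.
  by rewrite /r /=; case: (c (f' y)); rewrite /= ?mul0r ?mul1r ?add0r ?addr0.
Qed.

Lemma rect_bound_sign (R : realFieldType) (X Y : finType) (g : X -> Y -> R) c k :
  rect_bound g c -> rect_bound (fun x y => (-1) ^+ k * g x y) c.
Proof.
move=> gc A B; under eq_bigr do rewrite -mulr_sumr.
by rewrite -mulr_sumr normrM normrX normrN1 expr1n mul1r.
Qed.

(** * Testing invertibility through a corner of the inverse *)

Lemma reduce_cV n (q : 'cV['F_2]_n.+1) :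
  q != 0 -> exists2 K : 'M_n.+1, K \in unitmx & K *m q = delta_mx 0 0.
Proof.
move=> q0; have rq : \rank q = 1%N.
  by apply/eqP; rewrite eqn_leq rank_leq_col lt0n mxrank_eq0.
exists (invmx (col_ebase q)); first by rewrite unitmx_inv col_ebase_unit.
(* Over F_2 the only invertible 1 by 1 matrix is 1, so no scalar is left over. *)
have U1 : row_ebase q = 1%:M.
  have := row_ebase_unit q; rewrite unitmxE det_mx11 [X in _ -> X = _]mx11_scalar.
  by case: (F2_cases (row_ebase q 0 0)) => ->; rewrite ?unitr0.
rewrite -{2}(mulmx_ebase q) U1 mulmx1 mulKmx ?col_ebase_unit // rq.
by apply/matrixP => i j; rewrite !mxE ord1 andbT; case: i => [[|i] Hi].
Qed.

(** A fixed choice depending on [q] alone, so that both players can apply it once [q] is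
    revealed. *)
Definition reducer n (q : 'cV['F_2]_n.+1) : 'M['F_2]_n.+1 :=
  odflt 1%:M [pick K | (K \in unitmx) && (K *m q == delta_mx 0 0)].

Lemma reducerP n (q : 'cV['F_2]_n.+1) :
  q != 0 -> reducer q \in unitmx /\ reducer q *m q = delta_mx 0 0.
Proof.
move=> q0; rewrite /reducer; case: pickP => [K /andP[? /eqP]|] //.
by have [K uK Kq] := reduce_cV q0 => /(_ K); rewrite uK Kq eqxx.
Qed.

Definition coreducer n (p : 'rV['F_2]_n.+1) : 'M['F_2]_n.+1 := (reducer p^T)^T.

Lemma coreducerP n (p : 'rV['F_2]_n.+1) :
  p != 0 -> coreducer p \in unitmx /\ p *m coreducer p = delta_mx 0 0.
Proof.
move=> p0; have [|uK Kp] := @reducerP _ p^T.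
  by rewrite -(inj_eq (@trmx_inj _ _ _)) trmxK trmx0.
rewrite unitmx_tr; split=> //; apply: trmx_inj.
by rewrite trmx_mul trmxK Kp trmx_delta.
Qed.

(** With e the first basis vector, the corner is e^T W^-1 e, where e^T = p M and e = K z r; the
    matrices cancel and p r remains. *)
Lemma invmx_corner n (K z M : 'M['F_2]_n.+1) (p : 'rV_n.+1) (r : 'cV_n.+1) :
  K *m z *m M \in unitmx -> p *m M = delta_mx 0 0 ->
  K *m (z *m r) = delta_mx 0 0 ->
  invmx (K *m z *m M) 0 0 = (p *m r) 0 0.
Proof.
move=> uW pM Kzr; set W := K *m z *m M.
have MWKz : M *m invmx W *m (K *m z) = 1%:M.
  by apply: mulmx1C; rewrite mulmxA mulmxV.
have -> : p *m r = (p *m M) *m invmx W *m (K *m (z *m r)).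
  by rewrite -[p in LHS]mulmx1 -MWKz !mulmxA.
by rewrite pM Kzr -rowE -colE !mxE.
Qed.

(* The zero cases, in which no reducer exists, return the verdict p r = 0, which
   is the right one when x + y is invertible. *)
Definition probe n (t : protocol 'M['F_2]_n.+1 'M['F_2]_n.+1) (p : 'rV['F_2]_n.+1)
    (q : 'cV_n.+1) (x y : 'M_n.+1) : bool :=
  [|| p == 0, q == 0 |
    run t (reducer q *m x *m coreducer p) (reducer q *m y *m coreducer p)].

Definition probe_ok n t (p : 'rV['F_2]_n.+1) (r : 'cV_n.+1) (x y : 'M_n.+1) : bool :=
  probe t p ((x + y) *m r) x y == ((p *m r) 0 0 == 0).

(** Announcing x r and y r becomes a sum over their 2^(2(n+1)) possible values. Once these are
    fixed, q is a constant, and each term is a rectangle times a run of [t] or a constant. *)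
Lemma multiplier_probe_ok (R : realFieldType) n t (p : 'rV['F_2]_n.+1) (r : 'cV_n.+1) :
  multiplier (2 ^+ (n.+1 + n.+1 + depth t)) (fun x y => (probe_ok t p r x y)%:R : R).
Proof.
pose b := (p *m r) 0 0 == 0.
pose h (ab : 'cV['F_2]_n.+1 * 'cV['F_2]_n.+1) (x y : 'M['F_2]_n.+1) : R :=
  ((x *m r == ab.1) && (y *m r == ab.2))%:R * (probe t p (ab.1 + ab.2) x y == b)%:R.
have mprobe q : multiplier (2 ^+ depth t) (fun x y => (probe t p q x y == b)%:R : R).
  rewrite /probe; case: (p == 0); case: (q == 0) => /=; try exact: multiplier_run;
  refine (multiplier_le _ (eq_multiplier (multiplier_rect (fun=> true == b) (fun=> true)) _));
  by [rewrite exprn_ege1 ?ler1n | move=> x y; rewrite andbT].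
have mh ab : multiplier (2 ^+ depth t) (h ab).
  refine (multiplier_le _ (multiplierM (multiplier_rect (fun x => x *m r == ab.1)
    (fun y => y *m r == ab.2)) (mprobe (ab.1 + ab.2)))).
  by rewrite mulr1.
have := multiplier_sum (fun=> ler01 : 0 <= 1 :> R) mh.
rewrite sumr_const card_prod card_mx card_Fp // muln1 -expnD natrX -exprD => msum.
refine (eq_multiplier msum _) => x y.
rewrite (bigD1 (x *m r, y *m r)) //= big1 => [|[u v] uv].
  by rewrite /h /= !eqxx !mul1r addr0 /probe_ok mulmxDl.
rewrite /h /=; case: eqP => [xu|]; case: eqP => [yv|]; rewrite /= ?mul0r ?mulr0 //.
by rewrite xu yv eqxx in uv.
Qed.

(** * The acceptance probability on invertible and on singular sums *)

Definition accept (R : realType) n (P : public_protocol R 'M['F_2]_n.+1 'M['F_2]_n.+1)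
    (x y : 'M['F_2]_n.+1) : R :=
  \sum_(p : 'rV['F_2]_n.+1) (2 ^- n.+1) * \sum_(r : 'cV['F_2]_n.+1) (2 ^- n.+1) *
    \sum_w coin_prob w * (probe_ok (protocol_of (p := P) w) p r x y)%:R.

Lemma sum_avg_F2 (R : realFieldType) m n :
  \sum_(p : 'M['F_2]_(m, n)) 2 ^- (m * n) = 1 :> R.
Proof.
rewrite sumr_const card_mx card_Fp // -[LHS]mulr_natl natrX.
by rewrite mulfV // expf_neq0 // pnatr_eq0.
Qed.

Lemma average_ge (R : realFieldType) (I : finType) (p f : I -> R) c :
  (forall i, 0 <= p i) -> \sum_i p i = 1 -> (forall i, c <= f i) ->
  c <= \sum_i p i * f i.
Proof.
move=> p0 p1 cf; rewrite -[c]mul1r -[X in X * c]p1 mulr_suml.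
by apply: ler_sum => i _; apply: ler_wpM2l.
Qed.

Lemma average_le (R : realFieldType) (I : finType) (p f : I -> R) c :
  (forall i, 0 <= p i) -> \sum_i p i = 1 -> (forall i, f i <= c) ->
  \sum_i p i * f i <= c.
Proof.
move=> p0 p1 fc; rewrite -[c]mul1r -[X in X * c]p1 mulr_suml.
by apply: ler_sum => i _; apply: ler_wpM2l.
Qed.

Lemma multiplier_average (R : realFieldType) (X Y I : finType) L (p : I -> R)
    (h : I -> X -> Y -> R) :
  (forall i, 0 <= p i) -> \sum_i p i = 1 -> (forall i, multiplier L (h i)) ->
  multiplier L (fun x y => \sum_i p i * h i x y).
Proof. by move=> p0 p1 mh; rewrite -[L]mul1r -[X in X * L]p1; apply: multiplier_sum. Qed.

Lemma multiplier_accept (R : realType) n (P : public_protocol R 'M['F_2]_n.+1 'M['F_2]_n.+1) :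
  multiplier (2 ^+ (n.+1 + n.+1 + cost P)) (accept P).
Proof.
have avg_ge0 k : 0 <= 2 ^- k :> R by rewrite invr_ge0 exprn_ge0.
have avg1 := sum_avg_F2 R 1 n.+1; rewrite mul1n in avg1.
have avg2 := sum_avg_F2 R n.+1 1; rewrite muln1 in avg2.
apply: multiplier_average => // p; apply: multiplier_average => // r.
apply: multiplier_average => [w||w]; [exact: coin_prob_ge0|exact: coin_prob_sum1|].
refine (multiplier_le _ (@multiplier_probe_ok R _ _ _ _)).
rewrite ler_weXn2l ?ler1n // leq_add2l.
exact: (leq_bigmax (F := fun w => depth (protocol_of w))).
Qed.

Lemma accept_ge0 (R : realType) n (P : public_protocol R 'M['F_2]_n.+1 'M['F_2]_n.+1) x y :
  0 <= accept P x y.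
Proof.
have avg_ge0 k : 0 <= 2 ^- k :> R by rewrite invr_ge0 exprn_ge0.
apply: sumr_ge0 => p _; apply: mulr_ge0 => //.
apply: sumr_ge0 => r _; apply: mulr_ge0 => //.
by apply: sumr_ge0 => w _; rewrite mulr_ge0 ?coin_prob_ge0.
Qed.

(** The bound holds for each [p] and [r] separately: the zero cases are always right, and otherwise
    the transformed inputs satisfy the promise and have corner p r by [invmx_corner]. *)
Lemma accept_unit (R : realType) n (delta : R)
    (P : public_protocol R 'M['F_2]_n.+1 'M['F_2]_n.+1) x y :
  0 <= delta -> solves delta (inverse_problem n) P -> x + y \in unitmx ->
  1 - delta <= accept P x y.
Proof.
move=> delta0 sP uz.
have avg_ge0 k : 0 <= 2 ^- k :> R by rewrite invr_ge0 exprn_ge0.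
have avg1 := sum_avg_F2 R 1 n.+1; rewrite mul1n in avg1.
have avg2 := sum_avg_F2 R n.+1 1; rewrite muln1 in avg2.
apply: average_ge => // p; apply: average_ge => // r.
set z := x + y in uz *.
have sum1 (b : bool) : b = true -> 1 - delta <= \sum_w coin_prob (p := P) w * b%:R.
  by move=> ->; under eq_bigr do rewrite mulr1; rewrite coin_prob_sum1 gerBl.
rewrite /probe_ok /probe; have [p0|p0] := eqVneq p 0.
  by apply: sum1; rewrite p0 mul0mx mxE eqxx.
have [q0|q0] := eqVneq (z *m r) 0.
  by apply: sum1; rewrite -(mulKmx uz r) q0 !mulmx0 mxE eqxx.
have [uK Kq] := reducerP q0; have [uM pM] := coreducerP p0.
set K := reducer _ in uK Kq *; set M := coreducer p in uM pM *.
have zE : K *m x *m M + K *m y *m M = K *m z *m M by rewrite -mulmxDl -mulmxDr.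
have uW : K *m z *m M \in unitmx by rewrite !unitmx_mul uK uz.
have := sP (K *m x *m M) (K *m y *m M); rewrite /= zE => /(_ uW).
rewrite (invmx_corner uW pM Kq) big_mkcond => /le_trans; apply.
by apply: ler_sum => w _; case: eqP; rewrite ?mulr1 ?mulr0.
Qed.

Lemma probe_ok_kernel n t (p : 'rV['F_2]_n.+1) (r k : 'cV_n.+1) x y :
  (x + y) *m k = 0 -> (p *m k) 0 0 = 1 ->
  probe_ok t p (r + k) x y = ~~ probe_ok t p r x y.
Proof.
move=> zk pk; rewrite /probe_ok mulmxDr zk addr0 mulmxDr mxE pk.
by case: (F2_cases ((p *m r) 0 0)) => ->; case: probe.
Qed.

(** If p k = 1, shifting [r] by [k] flips the outcome, so exactly half of the [r] succeed; if p k =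
    0, the trivial bound 1 is used. Writing these values as 3/4 plus or minus 1/4 lets orthogonality
    average over [p]. *)
Lemma sum_probe_ok_le (R : realFieldType) n t (p : 'rV['F_2]_n.+1) (k : 'cV_n.+1) x y :
  (x + y) *m k = 0 ->
  \sum_r 2 ^- n.+1 * (probe_ok t p r x y)%:R <= 3 / 4 + sgn R ((p *m k) 0 0) / 4.
Proof.
move=> zk; rewrite -mulr_sumr.
case: (F2_cases ((p *m k) 0 0)) => pk; rewrite pk ?sgn0 ?sgn1.
  apply: (@le_trans _ _ 1); last lra.
  rewrite mulr_sumr; apply: average_le => [r||r]; first by rewrite invr_ge0 exprn_ge0.
    by have := sum_avg_F2 R n.+1 1; rewrite muln1.
  by rewrite lern1 leq_b1.
set S := \sum_r _; have SS : S + S = 2 ^+ n.+1.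
  rewrite {2}/S (reindex_inj (addIr k)) -big_split /=.
  rewrite (eq_bigr (fun=> 1)) => [|r _].
    by rewrite sumr_const card_mx card_Fp // muln1 natrX.
  by rewrite (probe_ok_kernel _ _ zk pk); case: probe_ok; rewrite ?addr0 ?add0r.
have -> : S = 2 ^+ n.+1 / 2 by rewrite -SS; field.
by rewrite mulKf ?expf_neq0 ?pnatr_eq0 //; lra.
Qed.

Lemma right_kernel_vector (F : fieldType) n (z : 'M[F]_n) :
  z \notin unitmx -> exists2 k : 'cV_n, k != 0 & z *m k = 0.
Proof.
rewrite -unitmx_tr -row_free_unit -kermx_eq0 => /rowV0Pn[u /sub_kermxP uz u0].
exists u^T; first by rewrite -(inj_eq (@trmx_inj _ _ _)) trmxK trmx0.
by apply: trmx_inj; rewrite trmx_mul trmxK uz trmx0.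
Qed.

Lemma accept_singular (R : realType) n
    (P : public_protocol R 'M['F_2]_n.+1 'M['F_2]_n.+1) x y :
  x + y \notin unitmx -> accept P x y <= 3 / 4.
Proof.
move=> /right_kernel_vector[k k0 zk].
have avg_ge0 m : 0 <= 2 ^- m :> R by rewrite invr_ge0 exprn_ge0.
have sgn_avg : \sum_(p : 'rV_n.+1) sgn R ((p *m k) 0 0) = 0.
  under eq_bigr do rewrite -trace_mx11.
  by rewrite sum_sgn_tr (negPf k0) mul0r.
have -> : 3 / 4 = \sum_(p : 'rV['F_2]_n.+1) 2 ^- n.+1 * (3 / 4 + sgn R ((p *m k) 0 0) / 4).
  rewrite -mulr_sumr big_split /= -[X in _ = _ * (_ + X)]mulr_suml sgn_avg mul0r addr0.
  rewrite sumr_const card_mx card_Fp // mul1n -[X in _ = _ * X]mulr_natl natrX.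
  by rewrite mulKf // expf_neq0 // pnatr_eq0.
apply: ler_sum => p _; apply: ler_wpM2l => //.
under eq_bigr do rewrite mulr_sumr; rewrite exchange_big /=.
under eq_bigr do (under eq_bigr do rewrite mulrCA; rewrite -mulr_sumr).
apply: average_le => [w||w]; [exact: coin_prob_ge0|exact: coin_prob_sum1|].
exact: sum_probe_ok_le.
Qed.

Theorem theorem5p16 (R : realType) :
  exists2 c : R, 0 < c &
    exists N : nat, forall m : nat, (N <= m)%N ->
      c * m.+1%:R ^+ 2 <= Rpub (1 / 20%:R : R) (inverse_problem m).
Proof.
(* With n = m + 1, the last inequality below gives C >= n^2 / 24 - O(n). Half of the leading
   coefficient is given up to absorb the linear term for n > 100. *)
exists (1 / 48); first lra.
exists 100%N => m m100.
have [|P [sP -> _]] := @Rpub_attained R _ _ (1 / 20%:R) (inverse_problem m); first lra.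
set C := cost P.
have a_ge0 : 0 <= (19 / 20) ^+ 12 :> R by rewrite exprn_ge0 //; lra.
have b_ge0 : 0 <= (3 / 4) ^+ 12 :> R by rewrite exprn_ge0 //; lra.
have hu x y : x + y \in unitmx -> (19 / 20) ^+ 12 <= accept P x y ^+ 12.
  move=> uz; apply: lerXn2r; rewrite ?nnegrE ?accept_ge0 //; first lra.
  by apply: le_trans (accept_unit _ sP uz); lra.
have hs x y : x + y \notin unitmx -> `|accept P x y ^+ 12| <= (3 / 4) ^+ 12.
  move=> sz; rewrite ger0_norm ?exprn_ge0 ?accept_ge0 //.
  apply: lerXn2r; rewrite ?nnegrE ?accept_ge0 ?accept_singular //; lra.
(* The ratio (19/15)^12 is about 17, above the threshold 12 at which the bound of
   [GL_fourier_correlation] becomes positive. *)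
have gap : 1 / 32 <= (19 / 20) ^+ 12 / 4 - 3 * (3 / 4) ^+ 12 :> R by lra.
have lower := GL_fourier_correlation a_ge0 b_ge0 hu hs.
have upper := multiplierX 12 (multiplier_accept P)
  (rect_bound_sign m.+1 (@GL_fourier_rect_bound R m.+1)) xpredT xpredT.
have := le_trans lower (le_trans (ler_norm _) upper).
rewrite mulrA ler_pM2r ?mulr_gt0 ?exprn_gt0 // => H.
(* The gap 1/32 accounts for the 5 in the exponent, and the power of [accept] for the factor 12. *)
have {H} : 2 ^+ 'C(m.+1, 2) <= 2 ^+ (5 + (m.+1 + m.+1 + C) * 12) :> R.
  rewrite exprD (exprM 2); have : 0 <= 2 ^+ 'C(m.+1, 2) :> R by rewrite exprn_ge0.
  move: H; rewrite -/C => H u0; have := le_trans (ler_wpM2r u0 gap) H.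
  lra.
rewrite ler_eXn2l ?ltr1n // => H.
rewrite mul1r ler_pdivrMl ?ltr0n // -natrX -natrM ler_nat.
have := mul_bin_diag m.+1 1; rewrite bin1 /=; nia.
Qed.
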